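(* Let $A$ be a finite-dimensional bialgebra over a field $\mathbf{k}$ with basis $\{c_i\}_{i\in I}$ and structure constants $$c_i\cdot c_j=\sum_{k\in I}F_{ij}^k c_k,\qquad \Delta(c_k)=\sum_{i,j\in I}G_{ij}^k\, c_i\otimes c_j ,$$ and unit map $u:\mathbf{k}\to A$. Assume that there are nonzero elements $a_i\in\mathbf{k}$ ($i\in I$) with $F_{ij}^k=G_{ij}^k\cdot\dfrac{a_k}{a_ia_j}$ for all $i,j,k\in I$. Let $(A^\imath,\diamond)$ be the vector space with the same basis $\{c_i\}_{i\in I}$ as $A$, equipped with the bilinear multiplication $c_i\diamond c_j=\sum_{k\in I}{}^\imath F_{ij}^k c_k$, where $${}^\imath F_{ij}^k=\sum_{i',j',k'\in I}G_{i'k'}^j\,G_{k'j'}^i\,F_{j'i'}^k\cdot\frac{1}{a_{k'}}\qquad\text{for any } i,j,k\in I.$$ Then $(A^\imath,\diamond)$ is an associative algebra with the unit $u(1)$.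
   Context: Here $\Delta$ is the comultiplication of $A$ and $u(1)$ is the identity element of $A$. *)

(* Defs.v *)
From HB Require Import structures.
From mathcomp Require Import all_boot all_order all_algebra all_field.

Set Implicit Arguments.
Unset Strict Implicit.
Unset Printing Implicit Defensive.

Import GRing.Theory.
Local Open Scope ring_scope.

(* U (x) V is modelled by coordinate matrices with respect to the library bases
   of U and V; [tlift_tens] and [tlift_uniq] are its universal property.
   The product of the algebra A (x) A is [tmul] below, not the ring product
   of square matrices. *)
Definition tensor (k : fieldType) (U V : vectType k) : Type :=
  'M[k]_(\dim {:U}, \dim {:V}).

HB.instance Definition _ (k : fieldType) (U V : vectType k) :=
  Vector.copy (tensor U V) 'M[k]_(\dim {:U}, \dim {:V}).

Section Tensor.
Variable k : fieldType.

Definition tens (U V : vectType k) (u : U) (v : V) : tensor U V :=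
  \matrix_(i, j) (coord (vbasis {:U}) i u * coord (vbasis {:V}) j v).

Definition tlift (U V : vectType k) (W : lmodType k) (B : U -> V -> W)
    (t : tensor U V) : W :=
  \sum_(i < \dim {:U}) \sum_(j < \dim {:V})
     (t : 'M[k]_(_, _)) i j *: B (vbasis {:U})`_i (vbasis {:V})`_j.

Lemma tens_bilinear (U V : vectType k) :
  bilinear_for *:%R *:%R (@tens U V).
Proof.
split=> [v a u u' | u a v v'].
  by apply/matrixP=> i j; rewrite !mxE linearP mulrDl -mulrA.
by apply/matrixP=> i j; rewrite !mxE linearP mulrDr mulrCA.
Qed.

Lemma tlift_linear (U V : vectType k) (W : lmodType k) (B : U -> V -> W) :
  linear (tlift B).
Proof.
move=> a s t; rewrite /tlift scaler_sumr -big_split; apply: eq_bigr => i _.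
rewrite scaler_sumr -big_split; apply: eq_bigr => j _ /=.
by rewrite !mxE scalerDl scalerA.
Qed.

HB.instance Definition _ (U V : vectType k) (W : lmodType k) (B : U -> V -> W) :=
  GRing.isLinear.Build k (tensor U V) W *:%R (tlift B) (tlift_linear B).

Lemma tlift_tens (U V : vectType k) (W : lmodType k) (B : U -> V -> W)
    (u : U) (v : V) :
  bilinear_for *:%R *:%R B -> tlift B (tens u v) = B u v.
Proof.
case=> Bl Br.
pose f w : {linear U -> W} :=
  HB.pack (B^~ w) (GRing.isLinear.Build k U W *:%R (B^~ w) (Bl w)).
pose g w : {linear V -> W} :=
  HB.pack (B w) (GRing.isLinear.Build k V W *:%R (B w) (Br w)).
rewrite [in RHS](coord_vbasis (memvf u)) -[RHS]/(f v _) linear_sum.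
apply: eq_bigr => i _; rewrite linearZ /=.
rewrite [in RHS](coord_vbasis (memvf v)) -[B _ _ in RHS]/(g _ _).
rewrite linear_sum scaler_sumr; apply: eq_bigr => j _.
by rewrite linearZ /= mxE scalerA.
Qed.

Lemma tens_vbasis (U V : vectType k) (i : 'I_(\dim {:U})) (j : 'I_(\dim {:V})) :
  tens (vbasis {:U})`_i (vbasis {:V})`_j = delta_mx i j :> 'M[k]_(_, _).
Proof.
apply/matrixP=> i' j'; rewrite !mxE.
rewrite !coord_free ?(basis_free (vbasisP _)) // -natrM mulnb.
by rewrite (eq_sym i) (eq_sym j).
Qed.

Lemma tlift_uniq (U V : vectType k) (W : lmodType k) (B : U -> V -> W)
    (f : {linear tensor U V -> W}) :
  (forall u v, f (tens u v) = B u v) -> f =1 tlift B.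
Proof.
move=> fB t; rewrite [t in LHS](matrix_sum_delta (t : 'M[k]_(_, _))).
rewrite (linear_sum f); apply: eq_bigr => i _.
rewrite (linear_sum f); apply: eq_bigr => j _.
by rewrite (linearZ_LR f) -tens_vbasis fB.
Qed.

Definition tmap (U V U' V' : vectType k) (f : U -> U') (g : V -> V') :
    tensor U V -> tensor U' V' :=
  tlift (fun u v => tens (f u) (g v)).

Definition tassoc (U V W : vectType k) :
    tensor (tensor U V) W -> tensor U (tensor V W) :=
  tlift (fun t w => tlift (fun u v => tens u (tens v w)) t).

Definition tmul (A : falgType k) (s t : tensor A A) : tensor A A :=
  tlift (fun x y => tlift (fun x' y' => tens (x * x') (y * y')) t) s.

End Tensor.

(* Falgebra excludes the zero algebra; so do the bialgebra axioms, since
   counit 1 = 1.  In [comul_counitl] and [comul_counitr] the identifications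
   k (x) A = A and A (x) k = A are composed with counit (x) id and
   id (x) counit. *)
HB.mixin Record Falgebra_isBialgebra (k : fieldType) A of Falgebra k A := {
  comul : A -> tensor A A;
  counit : A -> k;
  comul_linear : linear comul;
  counit_linear : scalar counit;
  comulA : forall x, tassoc (tmap comul idfun (comul x)) =
                     tmap idfun comul (comul x);
  comul_counitl : forall x, tlift (fun y z => counit y *: z) (comul x) = x;
  comul_counitr : forall x, tlift (fun y z => counit z *: y) (comul x) = x;
  comulM : forall x y, comul (x * y) = tmul (comul x) (comul y);
  comul1 : comul 1 = tens 1 1;
  counitM : forall x y, counit (x * y) = counit x * counit y;
  counit1 : counit 1 = 1
}.

#[short(type="finBialgType")]
HB.structure Definition FinBialgebra (k : fieldType) :=
  { A of Falgebra k A & Falgebra_isBialgebra k A }.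

Section StructureConstants.
Variables (k : fieldType) (I : finType).

Definition is_basis (V : vectType k) (c : I -> V) : bool :=
  basis_of {:V} (codom c).

Definition bcoord (V : vectType k) (c : I -> V) (i : I) (x : V) : k :=
  coord (codom_tuple c) (enum_rank i) x.

Definition mul_of_consts (V : vectType k) (c : I -> V) (H : I -> I -> I -> k)
    (x y : V) : V :=
  \sum_i \sum_j (bcoord c i x * bcoord c j y) *: \sum_l H i j l *: c l.

Definition iota_const (F G : I -> I -> I -> k) (a : I -> k) (i j l : I) : k :=
  \sum_i' \sum_j' \sum_l' G i' l' j * G l' j' i * F j' i' l * (1 / a l').

Lemma bcoord_basis (V : vectType k) (c : I -> V) (i j : I) :
  is_basis c -> bcoord c i (c j) = (i == j)%:R.
Proof.
move=> cb; have cfree : free (codom_tuple c) by exact: basis_free cb.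
have -> : c j = (codom_tuple c)`_(enum_rank j).
  by rewrite /= codomE (nth_map j) -?cardE ?nth_enum_rank.
rewrite /bcoord coord_free // eq_sym.
by rewrite (inj_eq enum_rank_inj).
Qed.

Lemma mul_of_consts_bilinear (V : vectType k) (c : I -> V)
    (H : I -> I -> I -> k) :
  bilinear_for *:%R *:%R (mul_of_consts c H).
Proof.
split=> [y b x x' | x b y y']; rewrite /mul_of_consts /bcoord /=.
  rewrite scaler_sumr -big_split; apply: eq_bigr => i _ /=.
  rewrite scaler_sumr -big_split; apply: eq_bigr => j _ /=.
  by rewrite linearP scalerA -scalerDl mulrDl mulrA.
rewrite scaler_sumr -big_split; apply: eq_bigr => i _ /=.
rewrite scaler_sumr -big_split; apply: eq_bigr => j _ /=.
by rewrite linearP scalerA -scalerDl mulrDr mulrCA.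
Qed.

Lemma mul_of_consts_basis (V : vectType k) (c : I -> V) (H : I -> I -> I -> k)
    (i j : I) :
  is_basis c -> mul_of_consts c H (c i) (c j) = \sum_l H i j l *: c l.
Proof.
move=> cb; rewrite /mul_of_consts (bigD1 i) //= [X in _ + X]big1 => [|i' ne].
  rewrite addr0 (bigD1 j) //= [X in _ + X]big1 => [|j' ne].
    by rewrite !bcoord_basis // !eqxx mulr1 scale1r addr0.
  by rewrite (bcoord_basis j') // (negbTE ne) mulr0 scale0r.
rewrite big1 // => j' _.
by rewrite (bcoord_basis i') // (negbTE ne) mul0r scale0r.
Qed.

End StructureConstants.

Definition assoc_unital_algebra (k : fieldType) (V : lmodType k)
    (mul : V -> V -> V) (one : V) : Prop :=
  [/\ bilinear_for *:%R *:%R mul, associative mul,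
      left_id one mul & right_id one mul].

(* Main.v *)
(* Put <c_i, c_j> = (i == j) / a_i.  The hypothesis on F and G says that the
   product and the coproduct are adjoint for this form:
     <xy, z> = <x, z_1> <y, z_2>  and  <x, yz> = <x_1, y> <x_2, z>,
   so <1, -> is a counit, and coassociativity follows from associativity.
   The new product is x <> y = <x_1, y_2> x_2 y_1, in Sweedler notation.  As the
   coproduct is multiplicative, (x <> y) <> z and x <> (y <> z) are both
     <x_1, y_3> <x_2, z_2> <y_1, z_3> x_3 y_2 z_1.  *)

Require Import Defs.
From HB Require Import structures.
From mathcomp Require Import all_boot all_order all_algebra all_field ring.

Set Implicit Arguments.
Unset Strict Implicit.
Unset Printing Implicit Defensive.

Import GRing.Theory.
Local Open Scope ring_scope.

(** * Sums against structure constants, written as evaluations of functionals *)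

Section DualOperators.
Variables (k : fieldType) (I : finType).
Implicit Types (w f : I -> k) (phi : I -> I -> k).

(** The functional with values [f] on the basis, evaluated at the vector with coordinates [w]. *)
Definition wsum w f : k := \sum_i w i * f i.

(* [dmul F f i j] is f (c_i c_j) and [dcomul G phi x] is phi (Delta c_x), for
   f and phi extended linearly from the basis. *)
Definition dmul (F : I -> I -> I -> k) f i j : k := wsum (F i j) f.
Definition dcomul (G : I -> I -> I -> k) phi x : k :=
  \sum_i \sum_j G i j x * phi i j.

Lemma eq_wsum w f f' : f =1 f' -> wsum w f = wsum w f'.
Proof. by move=> eqf; apply: eq_bigr => i _; rewrite eqf. Qed.

Lemma eq_dmul F f f' i j : f =1 f' -> dmul F f i j = dmul F f' i j.
Proof. exact: eq_wsum. Qed.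

Lemma eq_dcomul G phi phi' x :
  phi =2 phi' -> dcomul G phi x = dcomul G phi' x.
Proof.
by move=> eqp; apply: eq_bigr => i _; apply: eq_bigr => j _; rewrite eqp.
Qed.

Lemma wsumMl w b f : wsum w (fun i => b * f i) = b * wsum w f.
Proof.
by rewrite /wsum big_distrr; apply: eq_bigr => i _ /=; rewrite mulrCA.
Qed.

Lemma wsumMr w b f : wsum w (fun i => f i * b) = wsum w f * b.
Proof.
by rewrite /wsum big_distrl; apply: eq_bigr => i _ /=; rewrite mulrA.
Qed.

Lemma dcomulMl G b phi x :
  dcomul G (fun i j => b * phi i j) x = b * dcomul G phi x.
Proof.
rewrite /dcomul big_distrr; apply: eq_bigr => i _ /=.
by rewrite big_distrr; apply: eq_bigr => j _ /=; rewrite mulrCA.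
Qed.

Lemma dcomulMr G b phi x :
  dcomul G (fun i j => phi i j * b) x = dcomul G phi x * b.
Proof.
rewrite /dcomul big_distrl; apply: eq_bigr => i _ /=.
by rewrite big_distrl; apply: eq_bigr => j _ /=; rewrite mulrA.
Qed.

Lemma wsum_comm w w' (h : I -> I -> k) :
  wsum w (fun i => wsum w' (h i)) = wsum w' (fun j => wsum w (h^~ j)).
Proof.
rewrite /wsum; under eq_bigr do rewrite big_distrr.
rewrite exchange_big; apply: eq_bigr => j _ /=.
by rewrite big_distrr; apply: eq_bigr => i _ /=; rewrite mulrCA.
Qed.

Lemma wsum_dcomul w G (h : I -> I -> I -> k) x :
  wsum w (fun m => dcomul G (h m) x) = dcomul G (fun i j => wsum w (fun m => h m i j)) x.
Proof.
rewrite /dcomul /wsum; under eq_bigr do rewrite big_distrr.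
rewrite exchange_big; apply: eq_bigr => i _ /=.
under eq_bigr do rewrite big_distrr.
rewrite exchange_big; apply: eq_bigr => j _ /=.
by rewrite big_distrr; apply: eq_bigr => m _ /=; rewrite mulrCA.
Qed.

Lemma dcomul_comm G (h : I -> I -> I -> I -> k) x y :
  dcomul G (fun i j => dcomul G (h i j) y) x =
  dcomul G (fun p q => dcomul G (fun i j => h i j p q) x) y.
Proof.
rewrite {1 4}/dcomul.
under eq_bigr => i _ do rewrite -/(wsum (fun j => G i j x) _) wsum_dcomul.
(* The constant weight 1 presents the plain sum over [i] as a [wsum], so that [wsum_dcomul] applies
   a second time. *)
transitivity (wsum (fun=> 1)
  (fun i => dcomul G (fun p q => wsum (fun j => G i j x) (fun j => h i j p q)) y)).
  by apply: eq_bigr => i _; rewrite mul1r.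
rewrite wsum_dcomul; apply: eq_bigr => p _; apply: eq_bigr => q _.
by congr (_ * _); apply: eq_bigr => i _; rewrite mul1r.
Qed.

End DualOperators.

(** * Adjointness of product and coproduct, and coassociativity *)

Section SelfDualConstants.
Variables (k : fieldType) (I : finType).
Variables (F G : I -> I -> I -> k) (a e : I -> k).
Local Notation M := (dmul F).
Local Notation D := (dcomul G).

Hypothesis a_neq0 : forall i, a i != 0.
Hypothesis F_G : forall i j l, F i j l = G i j l * (a l / (a i * a j)).
(** The algebra and compatibility axioms on basis vectors, tested against arbitrary functionals; [e]
    stands for the coordinates of 1. *)
Hypothesis mulA : forall f i j m,
  M (fun p => M f p m) i j = M (fun p => M f i p) j m.
Hypothesis mul_comul : forall (phi : I -> I -> k) i j,
  M (D phi) i j =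
  D (fun r s => D (fun t u => M (fun p => M (phi p) s u) r t) j) i.
Hypothesis mul1 : forall f j, wsum e (fun i => M f i j) = f j.
Hypothesis mulr1 : forall f i, wsum e (fun j => M f i j) = f i.
Hypothesis comul1 : forall phi : I -> I -> k,
  wsum e (D phi) = wsum e (fun p => wsum e (phi p)).

Definition dpair i j : k := (i == j)%:R / a i.
Local Notation P := dpair.

Lemma dpairC i j : P i j = P j i.
Proof. by rewrite /dpair eq_sym; case: eqP => [->|_] //; rewrite !mul0r. Qed.

Lemma sum_dpair f i : \sum_j P i j * f j = f i / a i.
Proof.
rewrite (bigD1 i) //= big1 => [|j nj].
  by rewrite addr0 /dpair eqxx mul1r mulrC.
by rewrite /dpair eq_sym (negbTE nj) !mul0r.
Qed.

Lemma dmul_dpairl i j z : M (P^~ z) i j = F i j z / a z.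
Proof. by rewrite -sum_dpair; apply: eq_bigr => l _; rewrite mulrC dpairC. Qed.

(** This is [F_G] read as <xy, z> = <x, z_1> <y, z_2>: both sides equal G i j z / (a i * a j). *)
Lemma dmul_dpair i j z :
  M (P^~ z) i j = D (fun u v => P i u * P j v) z.
Proof.
rewrite dmul_dpairl /dcomul; under eq_bigr => u _.
  under eq_bigr do rewrite mulrCA [G _ _ _ * _]mulrC.
  rewrite -big_distrr sum_dpair.
  over.
rewrite sum_dpair F_G.
by field; rewrite !a_neq0.
Qed.

Lemma dmul_dpairr i j z :
  M (P z) i j = D (fun u v => P u i * P v j) z.
Proof.
transitivity (M (P^~ z) i j); first by apply: eq_wsum => l; rewrite dpairC.
by rewrite dmul_dpair; apply: eq_dcomul => u v; rewrite ![P _ i]dpairC ![P _ j]dpairC.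
Qed.

Lemma dcomulA (h : I -> I -> I -> k) x :
  D (fun i j => D (fun p q => h p q j) i) x =
  D (fun p i => D (fun q j => h p q j) i) x.
Proof.
(* Associativity is tested against the functional <-, c_x>. Multiplying by a p * a q * a j then
   cancels every weight and turns products of [F] into products of [G]. *)
have GA p q j : \sum_m G p q m * G m j x = \sum_m G q j m * G p m x.
  have := mulA (P^~ x) p q j.
  rewrite [LHS](eq_wsum _ (f' := fun m => F m j x / a x)) => [|m]; last exact: dmul_dpairl.
  rewrite [RHS](eq_wsum _ (f' := fun m => F p m x / a x)) => [|m]; last exact: dmul_dpairl.
  move/(congr1 ( *%R^~ (a p * a q * a j))); rewrite /wsum !big_distrl /= => E.
  transitivity (\sum_i F p q i * (F i j x / a x) * (a p * a q * a j)).
    by apply: eq_bigr => m _; rewrite !F_G; field; rewrite !a_neq0.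
  by rewrite E; apply: eq_bigr => m _; rewrite !F_G; field; rewrite !a_neq0.
transitivity (\sum_p \sum_q \sum_j (\sum_m G p q m * G m j x) * h p q j).
  rewrite /dcomul.
  under eq_bigr => i _.
    under eq_bigr => j _.
      rewrite big_distrr; under eq_bigr do rewrite big_distrr.
      over.
    rewrite exchange_big; under eq_bigr do rewrite exchange_big.
    over.
  rewrite exchange_big; apply: eq_bigr => p _ /=.
  rewrite exchange_big; apply: eq_bigr => q _ /=.
  rewrite exchange_big; apply: eq_bigr => j _ /=.
  by rewrite big_distrl; apply: eq_bigr => m _ /=; rewrite mulrCA mulrA.
apply: eq_bigr => p _ /=.
under [RHS]eq_bigr => i _.
  rewrite /dcomul big_distrr; under eq_bigr do rewrite big_distrr.
  over.
rewrite [RHS]exchange_big; apply: eq_bigr => q _ /=.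
rewrite [RHS]exchange_big; apply: eq_bigr => j _ /=.
by rewrite GA big_distrl; apply: eq_bigr => m _ /=; rewrite mulrCA mulrA.
Qed.

(** * The new product: Sweedler form, associativity and unit *)

Local Notation K := (dmul (iota_const F G a)).

(** The Sweedler form f (x <> y) = <x_1, y_2> f (x_2 y_1): [P p s] identifies the two indices that
    [iota_const] calls l' and supplies the factor 1 / a l'. *)
Lemma iota_dmulE f x y :
  K f x y = D (fun p q => D (fun r s => P p s * M f q r) y) x.
Proof.
transitivity (\sum_p \sum_q \sum_r G p q x * (G r p y * (M f q r / a p))).
  rewrite /dmul /wsum /iota_const.
  under eq_bigr => l _.
    rewrite big_distrl; under eq_bigr => r _.
      rewrite big_distrl; under eq_bigr do rewrite big_distrl.
      over.
    over.
  rewrite exchange_big.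
  under eq_bigr => r _.
    rewrite exchange_big; under eq_bigr do rewrite exchange_big.
    rewrite exchange_big; over.
  rewrite exchange_big; apply: eq_bigr => p _ /=.
  rewrite exchange_big; apply: eq_bigr => q _ /=.
  apply: eq_bigr => r _; rewrite big_distrl /= !big_distrr /=.
  by apply: eq_bigr => l _; rewrite mul1r; ring.
apply: eq_bigr => p _; apply: eq_bigr => q _; rewrite -big_distrr /=.
congr (_ * _); apply: eq_bigr => r _.
under [RHS]eq_bigr do rewrite mulrCA.
by rewrite sum_dpair -!mulrA.
Qed.

Lemma iota_dmulA f x y z :
  K (fun m => K f m z) x y = K (fun m => K f x m) y z.
Proof.
(* Both sides reduce to the value of f on
   <x_1, y_3> <x_2, z_2> <y_1, z_3> x_3 (y_2 z_1). *)
transitivity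
  (D (fun x1 x23 => D (fun x2 x3 =>
   D (fun y12 y3 => D (fun y1 y2 =>
   D (fun z1 z23 => D (fun z2 z3 =>
     P x1 y3 * (P x2 z2 * P y1 z3 * M (M f x3) y2 z1))
   z23) z) y12) y) x23) x).
  rewrite iota_dmulE; apply: eq_dcomul => x1 x23.
  rewrite [RHS]dcomul_comm; apply: eq_dcomul => y12 y3.
  (* By multiplicativity, the coproduct of [x23] times [y12] has factors [x2] [y1] and [x3] [y2]. *)
  rewrite (eq_dmul _ _ _ (fun m => iota_dmulE f m z)) mul_comul -dcomulMl.
  apply: eq_dcomul => x2 x3; rewrite -dcomulMl; apply: eq_dcomul => y1 y2.
  rewrite [X in _ * X](_ : _ = D (fun z1 z23 => D (fun z2 z3 =>
    P x2 z2 * P y1 z3 * M (M f x3) y2 z1) z23) z).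
    by rewrite -dcomulMl; apply: eq_dcomul => z1 z23; rewrite dcomulMl.
  transitivity (M (fun p => D (fun z1 z23 =>
      P p z23 * M (M f x3) y2 z1) z) x2 y1).
    apply: eq_wsum => p; rewrite /dmul wsum_dcomul.
    apply: eq_dcomul => z1 z23; rewrite wsumMl; congr (_ * _).
    exact: mulA.
  rewrite /dmul wsum_dcomul; apply: eq_dcomul => z1 z23.
  (* Adjointness splits <x2 y1, z23> into <x2, z2> <y1, z3>. *)
  by rewrite wsumMr -/(dmul F _ x2 y1) dmul_dpair dcomulMr.
(* Coassociativity in each variable passes to the bracketing that arises from x <> (y <> z). *)
transitivity
  (D (fun x12 x3 => D (fun x1 x2 =>
   D (fun y1 y23 => D (fun y2 y3 =>
   D (fun z12 z3 => D (fun z1 z2 =>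
     P x1 y3 * (P x2 z2 * P y1 z3 * M (M f x3) y2 z1))
   z12) z) y23) y) x12) x).
  rewrite -dcomulA; apply: eq_dcomul => x12 x3; apply: eq_dcomul => x1 x2.
  rewrite dcomulA; apply: eq_dcomul => y1 y23; apply: eq_dcomul => y2 y3.
  by rewrite -dcomulA.
rewrite iota_dmulE.
transitivity (D (fun y1 y23 => D (fun x12 x3 => D (fun z12 z3 =>
   P y1 z3 * M (fun m => D (fun r s => P x12 s * M f x3 r) m) y23 z12) z) x) y).
  rewrite dcomul_comm; apply: eq_dcomul => x12 x3.
  rewrite dcomul_comm; apply: eq_dcomul => y1 y23.
  rewrite dcomul_comm.
  under [RHS]eq_dcomul => z12 z3.
    (* Here the coproduct of [y23] times [z12] has factors [y2] [z1] and [y3] [z2]; adjointness will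
       split <x12, y3 z2> into <x1, y3> <x2, z2>. *)
    rewrite mul_comul -dcomulMl.
    under eq_dcomul do rewrite -dcomulMl.
    over.
  rewrite [RHS]dcomul_comm; apply: eq_dcomul => y2 y3.
  rewrite dcomul_comm; apply: eq_dcomul => z12 z3.
  rewrite dcomul_comm; apply: eq_dcomul => z1 z2.
  rewrite /dmul; under [in RHS]eq_wsum do rewrite wsumMr.
  rewrite wsumMl -!/(dmul F _ _ _) dmul_dpairr -dcomulMr -dcomulMl.
  by apply: eq_dcomul => x1 x2; rewrite /dmul; ring.
apply: eq_dcomul => y1 y23; rewrite dcomul_comm; apply: eq_dcomul => z12 z3.
rewrite dcomulMl -wsum_dcomul; congr (_ * _).
by apply: eq_wsum => m; rewrite iota_dmulE.
Qed.

(** The functional <1, -> is a left counit, since <1, x_1> <y, x_2> = <1 y, x> = <y, x>. In the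
    proof, the factor [a q] offsets the weight of the form. *)
Lemma dcomul_counit f x : D (fun p q => wsum e (P^~ p) * f q) x = f x.
Proof.
transitivity (\sum_q P x q * (a q * f q)); last first.
  by rewrite sum_dpair mulrAC divff ?mul1r.
rewrite /dcomul exchange_big; apply: eq_bigr => q _ /=.
rewrite dpairC -(mul1 (P^~ x) q) [RHS]big_distrl; apply: eq_bigr => p _ /=.
rewrite dmul_dpairl F_G /wsum.
under eq_bigr do rewrite mulrC dpairC.
by rewrite sum_dpair; field; rewrite !a_neq0.
Qed.

Lemma dcomul_counitr f x : D (fun p q => wsum e (P q) * f p) x = f x.
Proof.
transitivity (\sum_p P x p * (a p * f p)); last first.
  by rewrite sum_dpair mulrAC divff ?mul1r.
apply: eq_bigr => p _ /=.
rewrite dpairC -(mulr1 (P^~ x) p) [RHS]big_distrl; apply: eq_bigr => q _ /=.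
rewrite dmul_dpairl F_G /wsum.
under eq_bigr do rewrite mulrC.
by rewrite sum_dpair; field; rewrite !a_neq0.
Qed.

(** As the coproduct of 1 is 1 (x) 1, the Sweedler form gives 1 <> y = <1, y_2> y_1, and the counit
    property applies. *)
Lemma iota_dmul1 f j : wsum e (fun i => K f i j) = f j.
Proof.
rewrite (eq_wsum _ (fun i => iota_dmulE f i j)) comul1.
under eq_wsum do rewrite wsum_dcomul.
rewrite wsum_dcomul -[RHS]dcomul_counitr; apply: eq_dcomul => r s.
rewrite -wsumMr; apply: eq_wsum => p.
by rewrite wsumMl mul1 dpairC.
Qed.

Lemma iota_dmulr1 f i : wsum e (fun j => K f i j) = f i.
Proof.
rewrite (eq_wsum _ (iota_dmulE f i)) wsum_dcomul -[RHS]dcomul_counit.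
apply: eq_dcomul => p q; rewrite comul1 wsum_comm -wsumMr.
by apply: eq_wsum => s; rewrite wsumMl mulr1 dpairC.
Qed.

End SelfDualConstants.

(** * Linear maps on linear combinations *)

Section LinearSums.
Variables (k : fieldType) (I : finType) (V : vectType k) (W : lmodType k).
Variables (f : V -> W) (f_lin : linear f).

Let lin_f : {linear V -> W} :=
  HB.pack f (GRing.isLinear.Build k V W *:%R f f_lin).

Lemma linear_lincomb (g : I -> k) (v : I -> V) :
  f (\sum_i g i *: v i) = \sum_i g i *: f (v i).
Proof.
rewrite -[f]/(lin_f : V -> W) linear_sum.
by apply: eq_bigr => i _; rewrite linearZ.
Qed.

Lemma linear_lincomb2 (g : I -> I -> k) (v : I -> I -> V) :
  f (\sum_i \sum_j g i j *: v i j) = \sum_i \sum_j g i j *: f (v i j).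
Proof.
rewrite -[f]/(lin_f : V -> W) linear_sum.
by apply: eq_bigr => i _; exact: linear_lincomb.
Qed.

End LinearSums.

(** * Functionals on V and on its tensor square, extended from a basis *)

Section LinearExtension.
Variables (k : fieldType) (I : finType) (V : vectType k) (c : I -> V).
Hypothesis c_basis : is_basis c.
Implicit Types (f : I -> k) (phi : I -> I -> k).

Lemma bcoord_sum x : x = \sum_i bcoord c i x *: c i.
Proof.
rewrite [LHS](coord_basis c_basis (memvf x)) (reindex (@enum_rank I)) /=.
  by apply: eq_bigr => i _; rewrite codomE (nth_map i) -?cardE ?nth_enum_rank.
exact/onW_bij/enum_rank_bij.
Qed.

Definition lin_ext f (x : V) : k^o := wsum (fun i => bcoord c i x) f.

Lemma lin_ext_linear f : linear (lin_ext f).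
Proof.
move=> b x y; rewrite /lin_ext /wsum scaler_sumr -big_split.
by apply: eq_bigr => i _; rewrite /bcoord linearP mulrDl -mulrA.
Qed.

Lemma lin_ext_basis f i : lin_ext f (c i) = f i.
Proof.
rewrite /lin_ext /wsum (bigD1 i) //= big1 => [|j nj].
  by rewrite addr0 bcoord_basis // eqxx mul1r.
by rewrite bcoord_basis // (negbTE nj) mul0r.
Qed.

(** The indicator of [l] extends to the [l]-th coordinate, so functionals separate vectors.
    Identities in V thus reduce to scalar ones. *)
Lemma lin_ext_inj x y : (forall f, lin_ext f x = lin_ext f y) -> x = y.
Proof.
move=> eqxy; rewrite [x]bcoord_sum [y]bcoord_sum.
apply: eq_bigr => l _; congr (_ *: _).
have ext_bcoord z : lin_ext (fun i => (i == l)%:R) z = bcoord c l z.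
  rewrite /lin_ext /wsum (bigD1 l) //= eqxx mulr1 big1 ?addr0 // => i ni.
  by rewrite (negbTE ni) mulr0.
by rewrite -!ext_bcoord.
Qed.

Lemma lin_ext_mul_of_consts H f x y :
  lin_ext f (mul_of_consts c H x y) =
  lin_ext (fun i => lin_ext (dmul H f i) y) x.
Proof.
rewrite /mul_of_consts (linear_lincomb2 (lin_ext_linear f)).
apply: eq_bigr => i _; rewrite [RHS]big_distrr; apply: eq_bigr => j _ /=.
rewrite (linear_lincomb (lin_ext_linear f)) -scalerA; congr (_ * (_ * _)).
by apply: eq_bigr => l _; rewrite lin_ext_basis.
Qed.

Definition lin_ext2 phi : tensor V V -> k^o :=
  tlift (fun u v => lin_ext (fun p => lin_ext (phi p) v) u).

Lemma lin_ext2_linear phi : linear (lin_ext2 phi).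
Proof. exact: tlift_linear. Qed.

Lemma lin_ext2_tens phi u v :
  lin_ext2 phi (tens u v) = lin_ext (fun p => lin_ext (phi p) v) u.
Proof.
rewrite /lin_ext2 tlift_tens //; split=> [w | w] b x y; first exact: lin_ext_linear.
rewrite [LHS](eq_wsum _ (fun p => lin_ext_linear (phi p) b x y)) /wsum.
under eq_bigr do rewrite mulrDr.
by rewrite big_split; congr (_ + _); exact: wsumMl.
Qed.

End LinearExtension.

Lemma mulrE_of_consts (k : fieldType) (A : falgType k) (I : finType)
    (c : I -> A) (F : I -> I -> I -> k) :
    is_basis c -> (forall i j, c i * c j = \sum_l F i j l *: c l) ->
  forall x y, x * y = mul_of_consts c F x y.
Proof.
move=> c_basis c_mul x y.
rewrite [in LHS](bcoord_sum c_basis x) [in LHS](bcoord_sum c_basis y) mulr_suml.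
apply: eq_bigr => i _; rewrite mulr_sumr; apply: eq_bigr => j _.
by rewrite -scalerAl -scalerAr scalerA c_mul.
Qed.

(** * The product on the tensor square of an algebra *)

Section TensorAlgebra.
Variables (k : fieldType) (A : falgType k).

Lemma tmul_linearl (t : tensor A A) : linear (fun s => tmul s t).
Proof. exact: tlift_linear. Qed.

(** The outer [tlift] in [tmul] runs over [s], so linearity in the right argument is checked summand
    by summand on the inner [tlift]. *)
Lemma tmul_linearr (s : tensor A A) : linear (tmul s).
Proof.
pose e := vbasis {:A}; pose B i j : tensor A A -> tensor A A :=
  tlift (fun x' y' => tens (e`_i * x') (e`_j * y')).
have tmulE t : tmul s t = \sum_i \sum_j (s : 'M[k]_(_, _)) i j *: B i j t by [].
move=> b t t'; rewrite !tmulE scaler_sumr -big_split; apply: eq_bigr => i _ /=.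
rewrite scaler_sumr -big_split; apply: eq_bigr => j _ /=.
by rewrite /B tlift_linear scalerDr !scalerA mulrC.
Qed.

Lemma tmul_tens (x x' y y' : A) :
  tmul (tens x y) (tens x' y') = tens (x * x') (y * y').
Proof.
have [tensl tensr] := @tens_bilinear k A A.
rewrite /tmul tlift_tens; last first.
  split=> [w | w] b u u' /=; rewrite /tlift scaler_sumr -big_split;
    apply: eq_bigr => i _ /=; rewrite scaler_sumr -big_split;
    apply: eq_bigr => j _ /=.
    by rewrite mulrDl -scalerAl tensl scalerDr !scalerA mulrC.
  by rewrite mulrDl -scalerAl tensr scalerDr !scalerA mulrC.
rewrite tlift_tens //; split=> [w | w] b u u' /=.
  by rewrite mulrDr -scalerAr tensl.
by rewrite mulrDr -scalerAr tensr.
Qed.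

End TensorAlgebra.

(** * Bialgebra axioms in coordinates, and the conclusion *)

Theorem proposition3p2 (k : fieldType) (A : finBialgType k) (I : finType)
    (c : I -> A) (F G : I -> I -> I -> k) (a : I -> k)
    (c_basis : is_basis c)
    (c_mul : forall i j : I, c i * c j = \sum_(l : I) F i j l *: c l)
    (c_comul : forall l : I,
       comul (c l) = \sum_(i : I) \sum_(j : I) G i j l *: tens (c i) (c j))
    (a_neq0 : forall i : I, a i != 0)
    (F_G : forall i j l : I, F i j l = G i j l * (a l / (a i * a j))) :
  assoc_unital_algebra (mul_of_consts c (iota_const F G a)) (1 : A).
Proof.
pose ext := lin_ext c; pose e i := bcoord c i (1 : A).
have extM f x y : ext f (x * y) = ext (fun i => ext (dmul F f i) y) x.
  by rewrite (mulrE_of_consts c_basis c_mul) /ext lin_ext_mul_of_consts.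
have extE f i : ext f (c i) = f i by exact: lin_ext_basis.
have eq_ext f f' x : f =1 f' -> ext f x = ext f' x by exact: eq_wsum.
have extMb f i j : ext f (c i * c j) = dmul F f i j by rewrite extM !extE.
have mulA f i j m :
    dmul F (fun p => dmul F f p m) i j = dmul F (fun p => dmul F f i p) j m.
  rewrite -extMb -[RHS]extMb.
  rewrite -[LHS](eq_ext (fun p => ext (dmul F f p) (c m))) => [|p].
    by rewrite -extM -mulrA extM extE.
  exact: extE.
have mul1 f j : wsum e (fun i => dmul F f i j) = f j.
  by rewrite -[RHS]extE -[c j]mul1r extM; apply: eq_wsum => i; rewrite extE.
have mulr1 f i : wsum e (fun j => dmul F f i j) = f i.
  by rewrite -[RHS]extE -[c i]mulr1 extM extE.
have ext2_lincomb phi (g : I -> I -> k) t :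
    lin_ext2 c phi (\sum_i \sum_j g i j *: t i j) =
    \sum_i \sum_j g i j * lin_ext2 c phi (t i j).
  by rewrite (linear_lincomb2 (lin_ext2_linear _ _)).
have ext2_comul phi x : lin_ext2 c phi (comul x) = ext (dcomul G phi) x.
  rewrite {1}(bcoord_sum c_basis x) (linear_lincomb comul_linear).
  rewrite (linear_lincomb (lin_ext2_linear _ _)); apply: eq_bigr => l _.
  rewrite c_comul ext2_lincomb; congr (_ * _); apply: eq_dcomul => i j.
  by rewrite lin_ext2_tens [LHS]extE [LHS]extE.
have comul1' phi : wsum e (dcomul G phi) = wsum e (fun p => wsum e (phi p)).
  by rewrite -[LHS]ext2_comul comul1 lin_ext2_tens.
have mul_comul phi i j : dmul F (dcomul G phi) i j =
    dcomul G (fun r s => dcomul G (fun t u =>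
      dmul F (fun p => dmul F (phi p) s u) r t) j) i.
  (* The axiom [comulM] for [c i] and [c j], evaluated by the functional that [phi] defines on the
     tensor square. *)
  rewrite -extMb -ext2_comul comulM [comul (c i)]c_comul.
  rewrite (linear_lincomb2 (tmul_linearl _)) ext2_lincomb.
  apply: eq_dcomul => r s; rewrite c_comul.
  rewrite (linear_lincomb2 (tmul_linearr _)) ext2_lincomb.
  apply: eq_dcomul => t u; rewrite tmul_tens lin_ext2_tens [LHS]extMb.
  by apply: eq_dmul => p; exact: extMb.
split; first exact: mul_of_consts_bilinear.
- move=> x y z; apply: (lin_ext_inj c_basis) => f.
  rewrite !lin_ext_mul_of_consts //; apply: eq_wsum => i.
  rewrite lin_ext_mul_of_consts //; apply: eq_wsum => j.
  (* With the sum over the coordinates of [z] moved outside, only associativity on basis vectors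
     remains. *)
  rewrite [RHS]wsum_comm; apply: eq_wsum => l.
  by rewrite -[LHS](iota_dmulA a_neq0 F_G mulA mul_comul).
- move=> y; apply: (lin_ext_inj c_basis) => f.
  rewrite lin_ext_mul_of_consts // [LHS]wsum_comm; apply: eq_wsum => j.
  exact: (iota_dmul1 a_neq0 F_G).
- move=> x; apply: (lin_ext_inj c_basis) => f.
  rewrite lin_ext_mul_of_consts //; apply: eq_wsum => i.
  exact: (iota_dmulr1 a_neq0 F_G).
Qed.
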